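(* Let $w\in W_n$. Then $w$ is compactly SCA-representable if and only if $\gamma(w)$ is an SCA pattern.
   Context: **Words.** $W_n$ is the set of finite words in the symbols $\sigma_1^{\pm1},\dots,\sigma_{n-1}^{\pm1}$ ($1$ is the empty word). **Cells.** A cell occupies two adjacent integer positions $(j,j+1)$ and is in one of eight states: $[N_j,N_{j+1}]$ (empty); $[s_j^{(i)},N_{j+1}]$, $[N_j,s_{j+1}^{(i)}]$, $[r_j^{(i)},N_{j+1}]$, $[N_j,l_{j+1}^{(i)}]$ (one strand); $[s_j^{(t)},s_{j+1}^{(t+1)}]$ (two straight strands); $[r_j^{(t)},l_{j+1}^{(t+1)}]$ (crossing of kind $T_1$, strand $t$ over strand $t+1$); $\overline{[r_j^{(t)},l_{j+1}^{(t+1)}]}$ (crossing of kind $T_2$, strand $t+1$ over strand $t$). Superscripts are strand numbers and the subscript is the position at which the strand enters, called the position of the strand in that generation. A strand marked $s$ (straight) leaves at the position where it enters, $r$ goes from $j$ to $j+1$, and $l$ goes from $j+1$ to $j$; strands marked $r$ or $l$ are said to turn. **Grid patterns.** An $n$-strand generation is a row of cells tiling the integer positions, all left positions having the same parity, containing exactly $n$ strands numbered $1,\dots,n$ from left to right. A grid pattern on $n$ strands is a finite or infinite list of $n$-strand generations (drawn upwards); $G_n$ is the set of these and $G_n^*$ the set of finite ones (including the empty list $[\,]$). A pattern $g\in G_n^*$ is compact if in each generation the position of the rightmost strand minus the position of the leftmost strand is $n-1$. **Continuity and rules.** For adjacent cells $A$ at $(j,j+1)$, $B$ at $(j+2,j+3)$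 of a generation, their child is the cell at $(j+1,j+2)$ of the next generation. $A$ sends a strand to the child if a strand leaves $A$ at $j+1$; $B$ does if a strand leaves $B$ at $j+2$. A grid pattern is continuous if the cells of each non-first generation are the children of adjacent pairs of the previous one and, for every adjacent pair $A,B$ (empty cells included) of a non-last generation, the left (right) position of the child is occupied iff $A$ (respectively $B$) sends a strand to it. A turning rule is a function $\tau:\{S,T,N\}^2\to\{S,T\}$ (the value at $(N,N)$ being irrelevant); it is a turning rule of a continuous pattern if for each adjacent pair $A,B$ with nonempty child the strands of the child are straight when $\tau(a,b)=S$ and all turn when $\tau(a,b)=T$, where $a$ (resp. $b$) is $N$, $S$ or $T$ according as $A$ (resp. $B$) sends no strand, a straight strand, or a turning strand to the child. A crossing rule is a function $\kappa:\{T_1,T_2,0\}^2\to\{T_1,T_2\}$; it is a crossing rule of the pattern if each child that is a crossing has kind $\kappa(a',b')$, where $a'$ (resp. $b'$) is the kind of crossing in $A$ (resp. $B$), or $0$ if there is none. An SCA pattern is a continuous grid pattern having at least one turning rule and at least one crossing rule; $S_n^*\subseteq G_n^*$ is the set of finite SCA patterns. **Representations.** $\psi:G_n^*\to W_n$ reads the cells of $g$ generation by generation (first to last) and left to right within a generation, replacing $[r_j^{(t)},l_{j+1}^{(t+1)}]$ by $\sigma_t$, $\overline{[r_j^{(t)},l_{j+1}^{(t+1)}]}$ by $\sigma_t^{-1}$, and every other cell by the empty word. A word $w\in W_n$ is compactly SCA-representable if there is a compact $g\in S_n^*$ with $\psi(g)=w$. **The map $\gamma:W_n\to G_n^*$.**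 $\gamma(1)=[\,]$. For $w\ne1$, $\gamma(w)=[\delta_1,\delta_2,\dots]$ is built one generation at a time, starting with remaining word $w_1=w$. In every generation strand $i$ enters at position $i$ for $1\le i\le n$. In a type A generation the cells have left positions odd (cells at $(1,2),(3,4),\dots$); in a type B generation left positions are even (cells at $(0,1),(2,3),\dots$). The first generation is of type A if the first letter $\sigma_a^{\pm1}$ of $w$ has $a$ odd and of type B if $a$ is even; afterwards types alternate. At step $r$, if $w_r=1$, stop and output the list built so far. Otherwise take the longest (possibly empty) prefix $x_1\cdots x_i$ of $w_r$ whose letters $x_h=\sigma_{a_h}^{\pm1}$ have all $a_h$ odd (if step $r$ is of type A) or all even (if of type B) and $a_1<a_2<\dots<a_i$. In $\delta_r$, for each $h\le i$ the cell at $(a_h,a_h+1)$ is $[r_{a_h}^{(a_h)},l_{a_h+1}^{(a_h+1)}]$ if $x_h=\sigma_{a_h}$ and $\overline{[r_{a_h}^{(a_h)},l_{a_h+1}^{(a_h+1)}]}$ if $x_h=\sigma_{a_h}^{-1}$; all other strands are straight. Then $w_{r+1}$ is $w_r$ with the prefix $x_1\cdots x_i$ removed. *)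

(* Defs.v *)
From mathcomp Require Import all_boot all_order all_algebra.

Set Implicit Arguments.
Unset Strict Implicit.
Unset Printing Implicit Defensive.

Import Order.TTheory GRing.Theory Num.Theory.

Local Open Scope ring_scope.

(* (a, true) is sigma_a and (a, false) is its formal inverse; words are not
   reduced. *)
Definition letter : Type := (nat * bool)%type.
Definition word := seq letter.
Definition is_word (n : nat) (w : word) : bool :=
  all (fun x : letter => (0 < x.1 < n)%N) w.

Inductive turn := Straight | Turn.
Inductive kind := T1 | T2.

(* The eight cell states (subscripts are omitted: a state does not record the
   location of the cell):
     CellN            [N, N]
     CellL Straight i [s^(i), N]            CellL Turn i     [r^(i), N]
     CellR Straight i [N, s^(i)]            CellR Turn i     [N, l^(i)]
     CellS t          [s^(t), s^(t+1)]
     CellX T1 t       [r^(t), l^(t+1)]      CellX T2 t       its overlined form *)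
Inductive cell :=
| CellN
| CellL of turn & nat
| CellR of turn & nat
| CellS of nat
| CellX of kind & nat.

Definition left_strand (c : cell) : option nat :=
  match c with
  | CellL _ i => Some i
  | CellS t | CellX _ t => Some t
  | CellN | CellR _ _ => None
  end.

Definition right_strand (c : cell) : option nat :=
  match c with
  | CellR _ i => Some i
  | CellS t | CellX _ t => Some t.+1
  | CellN | CellL _ _ => None
  end.

(* How the strand leaving c at its right (resp. left) position goes through c;
   None stands for N, i.e. no strand leaves there. *)
Definition send_right (c : cell) : option turn :=
  match c with
  | CellL Turn _ | CellX _ _ => Some Turn
  | CellR Straight _ | CellS _ => Some Straight
  | CellN | CellL Straight _ | CellR Turn _ => None
  end.

Definition send_left (c : cell) : option turn :=
  match c with
  | CellR Turn _ | CellX _ _ => Some Turn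
  | CellL Straight _ | CellS _ => Some Straight
  | CellN | CellR Straight _ | CellL Turn _ => None
  end.

(* In every cell state either all strands are straight or all of them turn. *)
Definition cell_turn (c : cell) : option turn :=
  match c with
  | CellN => None
  | CellL m _ | CellR m _ => Some m
  | CellS _ => Some Straight
  | CellX _ _ => Some Turn
  end.

Definition cell_kind (c : cell) : option kind :=
  if c is CellX k _ then Some k else None.

(* A row of cells tiling the integers, all but finitely many being empty: the
   k-th cell of gcells has left position gstart + 2 k, and every other cell of
   the tiling is empty.  Padding gcells with empty cells describes the same
   row. *)
Record generation := Generation { gstart : int; gcells : seq cell }.

Definition is_left_pos (d : generation) (j : int) : bool :=
  (2 %| j - gstart d)%Z.

(* Meaningful only when is_left_pos d j. *)
Definition cell_at (d : generation) (j : int) : cell :=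
  if ((j - gstart d) %/ 2)%Z is Posz k then nth CellN (gcells d) k else CellN.

Definition strand_at (d : generation) (j : int) : option nat :=
  if is_left_pos d j then left_strand (cell_at d j)
  else right_strand (cell_at d (j - 1)).

(* The last clause also says that each number is used at most once. *)
Definition is_generation (n : nat) (d : generation) : Prop :=
  [/\ forall (j : int) (t : nat), strand_at d j = Some t -> (0 < t <= n)%N,
      forall t : nat, (0 < t <= n)%N -> exists j : int, strand_at d j = Some t
    & forall (j k : int) (s t : nat),
        strand_at d j = Some s -> strand_at d k = Some t ->
        j < k -> (s < t)%N].

Definition pattern := seq generation.

Definition is_grid_pattern (n : nat) (g : pattern) : Prop :=
  forall (r : nat) (d : generation), onth g r = Some d -> is_generation n d.

Definition leftmost (d : generation) (j : int) : Prop :=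
  strand_at d j <> None /\ forall k : int, strand_at d k <> None -> j <= k.

Definition rightmost (d : generation) (j : int) : Prop :=
  strand_at d j <> None /\ forall k : int, strand_at d k <> None -> k <= j.

Definition is_compact (n : nat) (g : pattern) : Prop :=
  forall (r : nat) (d : generation), onth g r = Some d ->
  forall j k : int, leftmost d j -> rightmost d k -> k - j = n%:Z - 1.

(* P A B C for all adjacent cells A, B of a non-last generation and their
   child C. *)
Definition for_children (g : pattern) (P : cell -> cell -> cell -> Prop) :=
  forall (r : nat) (d d' : generation),
    onth g r = Some d -> onth g r.+1 = Some d' ->
  forall j : int, is_left_pos d j ->
    P (cell_at d j) (cell_at d (j + 2)) (cell_at d' (j + 1)).

Definition is_continuous (g : pattern) : Prop :=
  (forall (r : nat) (d d' : generation),
     onth g r = Some d -> onth g r.+1 = Some d' ->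
   forall j : int, is_left_pos d' (j + 1) = is_left_pos d j) /\
  for_children g (fun A B C =>
    (left_strand C <> None <-> send_right A <> None) /\
    (right_strand C <> None <-> send_left B <> None)).

Definition is_turning_rule (tau : option turn -> option turn -> turn)
    (g : pattern) : Prop :=
  for_children g (fun A B C =>
    C <> CellN -> cell_turn C = Some (tau (send_right A) (send_left B))).

Definition is_crossing_rule (kappa : option kind -> option kind -> kind)
    (g : pattern) : Prop :=
  for_children g (fun A B C =>
    forall (k : kind) (t : nat),
      C = CellX k t -> k = kappa (cell_kind A) (cell_kind B)).

Definition is_SCA_pattern (n : nat) (g : pattern) : Prop :=
  [/\ is_grid_pattern n g,
      is_continuous g,
      exists tau, is_turning_rule tau g
    & exists kappa, is_crossing_rule kappa g].

Definition cell_word (c : cell) : word :=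
  match c with
  | CellX T1 t => [:: (t, true)]
  | CellX T2 t => [:: (t, false)]
  | _ => [::]
  end.

Definition psi (g : pattern) : word :=
  flatten [seq flatten [seq cell_word c | c <- gcells d] | d <- g].

Definition compactly_SCA_representable (n : nat) (w : word) : Prop :=
  exists g : pattern, [/\ is_SCA_pattern n g, is_compact n g & psi g = w].

(* Type A is p = true (odd left positions), type B is p = false. *)
Definition admissible (p : bool) (u : word) : bool :=
  all (fun x : letter => odd x.1 == p) u &&
  sorted ltn [seq x.1 | x : letter <- u].

Definition prefix_size (p : bool) (w : word) : nat :=
  \max_(i < (size w).+1 | admissible p (take i w)) i.

(* The cell at (j, j+1), strand i entering at position i for 0 < i <= n. *)
Definition gamma_cell (n : nat) (u : word) (j : nat) : cell :=
  if (j, true) \in u then CellX T1 j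
  else if (j, false) \in u then CellX T2 j
  else match (0 < j <= n)%N, (j.+1 <= n)%N with
       | true, true => CellS j
       | true, false => CellL Straight j
       | false, true => CellR Straight j.+1
       | false, false => CellN
       end.

Definition gamma_gen (n : nat) (p : bool) (u : word) : generation :=
  Generation (nat_of_bool p)%:Z
    [seq gamma_cell n u (p + k.*2) | k <- iota 0 (n./2).+1].

Fixpoint gamma_from (n fuel : nat) (p : bool) (w : word) : pattern :=
  match fuel, w with
  | fuel'.+1, _ :: _ =>
      let i := prefix_size p w in
      gamma_gen n p (take i w) :: gamma_from n fuel' (~~ p) (drop i w)
  | _, _ => [::]
  end.

Definition gamma (n : nat) (w : word) : pattern :=
  if w is x :: _ then gamma_from n (size w).*2 (odd x.1) w else [::].

Lemma prefix_size_gt0 (p : bool) (x : letter) (w : word) :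
  odd x.1 == p -> (0 < prefix_size p (x :: w))%N.
Proof.
move=> px; rewrite /prefix_size.
have h : (1 < (size (x :: w)).+1)%N by [].
apply: (@leq_trans (Ordinal h)) => //.
by apply: (@leq_bigmax_cond _ _ (fun i : 'I__ => (i : nat)) (Ordinal h));
  rewrite /= /admissible take0 /= px.
Qed.

(* The fuel used by gamma never runs out. *)
Lemma gamma_from_fuel (n f : nat) (p : bool) (w : word) :
  ((size w).*2 + (if w is x :: _ then odd x.1 != p else false) <= f)%N ->
  gamma_from n f.+1 p w = gamma_from n f p w.
Proof.
elim: f p w => [|f IHf] p [|x w] //= hf.
congr (_ :: _); apply: (IHf (~~ p) (drop _ _)).
have [px|px] := eqVneq (odd x.1) p.
  have := @prefix_size_gt0 p x w; rewrite px => /(_ (eqxx _)).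
  case: (prefix_size _ _) => // i _ /=.
  move: hf; rewrite px eqxx addn0 doubleS ltnS => hf.
  apply: leq_trans hf; rewrite -addn1 leq_add ?leq_double ?size_drop ?leq_subr //.
  by case: (drop _ _) => // y ?; case: (_ != _).
have -> : prefix_size p (x :: w) = 0%N.
  apply/eqP; rewrite -leqn0; apply/bigmax_leqP => -[[|i] hi] //=.
  by rewrite /admissible /= (negbTE px).
move: hf; rewrite drop0 /= px addn1 ltnS => hf.
have -> : odd x.1 = ~~ p by move: px; case: (odd _); case: (p).
by rewrite eqxx addn0.
Qed.

(* Main.v *)
Require Import Defs.
From mathcomp Require Import all_boot all_order all_algebra zify.

Set Implicit Arguments.
Unset Strict Implicit.
Unset Printing Implicit Defensive.

Import Order.TTheory GRing.Theory Num.Theory.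

Local Open Scope ring_scope.

(** If gamma w is an SCA pattern then it is itself a compact SCA pattern that
reads w, so the content is the converse.  Let g be a compact SCA pattern with
psi g = w; words without letters are trivial, so let there be a crossing, and
hence at least two strands.

In a compact generation the strands fill consecutive positions c + 1, ...,
c + n (compact_framed).  If a strand alone in its cell turned, it would leave
this block and become isolated in the next generation; so in every generation
but the last all single strands are straight, and the frame c is the same
throughout g (steady_step, frame_step).  Such a generation is therefore the
generation that gamma would build from the word of its crossings (steady_cell).
In the last generation a single strand may turn, but the cells holding two
strands are still those of gamma (inner_cell).

It remains to see that the words u_0, u_1, ... of the generations of g, starting
at the first nonempty one, are cut as gamma cuts w, that is, that each u_r is the
longest admissible prefix of u_r u_(r+1) ... (greedy_parse).  After a
generation without crossings every child holding two strands has two straight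
parents, so its state is decided by the single value tau(S, S): the next
generation has no crossings at all, or all possible ones.  If u_r could be
prolonged by the next letter x, parity would force u_(r+1) to be empty and x to
come later.  As x does come, empty words are followed by full ones, so u_(r+2) is
full and starts with x.  So x has the smallest index of its parity, and u_r, whose
letters have smaller indices of that parity, is empty as well; r is not 0, as u_0
is nonempty.  But then u_(r+1) is both full and empty, which needs n = 2 and the
parity with no room for a crossing; in that case u_(r-1) is empty by lack of room,
so u_r is full and contains a letter, a contradiction.

Hence the generations of gamma w are those of g from its first to its last
crossing, up to a translation and the behaviour of single strands in the last one.  The rules of g work for gamma w,
once the turning rule is changed to keep straight every child receiving only one
strand: in gamma w these are all straight (SCA_gamma_psi). *)

(** * Framed generations *)

Definition gen_word (d : generation) : word :=
  flatten [seq cell_word c | c <- gcells d].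

Definition strand_in (n : nat) (j : int) : option nat :=
  if j is Posz k then if (0 < k <= n)%N then Some k else None else None.

(** Strand i is at position c + i for all i; this is the shape of a compact
generation. *)
Definition framed (n : nat) (c : int) (d : generation) : Prop :=
  forall j : int, strand_at d (c + j) = strand_in n j.

(** Each strand of the cell leaves at a position at which some strand of the cell
enters; only a turning strand alone in its cell fails this. *)
Definition steady (C : cell) : bool :=
  match C with CellL Turn _ | CellR Turn _ => false | _ => true end.

Definition kind_of (b : bool) : kind := if b then T1 else T2.

Lemma strand_inP n j : strand_in n j <> None <-> (0 < j <= n%:Z).
Proof.
case: j => k /=; last by split=> //; lia.
by case: ifP => hk; split=> //; lia.
Qed.

Lemma strand_in_Some n j t : strand_in n j = Some t ->
  j = t%:Z /\ (0 < t <= n)%N.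
Proof. by case: j => k //=; case: ifP => // hk [<-]. Qed.

Lemma strand_in_nat n t : (0 < t <= n)%N -> strand_in n t%:Z = Some t.
Proof. by move=> /= ->. Qed.

Lemma strand_in_None n j : strand_in n j = None -> ~~ (0 < j <= n%:Z).
Proof. by move=> h; apply/negP => /strand_inP. Qed.

Lemma framedP n c d j : framed n c d ->
  strand_at d j <> None <-> (0 < j - c <= n%:Z).
Proof.
by move=> hd; rewrite -strand_inP -hd; have -> : c + (j - c) = j by lia.
Qed.

Lemma framed_generation n c d : framed n c d -> is_generation n d.
Proof.
move=> hd.
have key j t : strand_at d j = Some t -> j = c + t%:Z /\ (0 < t <= n)%N.
  have {1}-> : j = c + (j - c) by lia.
  by rewrite hd => /strand_in_Some[]; lia.
split.
- by move=> j t /key[].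
- by move=> t ht; exists (c + t%:Z); rewrite hd strand_in_nat.
- by move=> j k s t /key[-> _] /key[-> _]; lia.
Qed.

Lemma framed_compact n c d j k : framed n c d ->
  leftmost d j -> rightmost d k -> k - j = n%:Z - 1.
Proof.
move=> hd [/(framedP _ hd) hj minj] [/(framedP _ hd) hk maxk].
have /minj h1 : strand_at d (c + 1) <> None by apply/(framedP _ hd); lia.
have /maxk h2 : strand_at d (c + n%:Z) <> None by apply/(framedP _ hd); lia.
lia.
Qed.

(** Positions increase strictly with the strand number, and the n strands have a
span of n - 1, so there is no room for gaps: counting from the leftmost strand
bounds the position of strand t below, counting from the rightmost one bounds it
above by the same value. *)
Lemma compact_framed n d : (0 < n)%N -> is_generation n d ->
    (forall j k, leftmost d j -> rightmost d k -> k - j = n%:Z - 1) ->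
  exists c, framed n c d.
Proof.
move=> n_gt0 [rng onto mono] cpt.
have [j1 hj1] := onto 1%N n_gt0.
have [jn hjn] : exists j, strand_at d j = Some n by apply: onto; lia.
have hspan : jn - j1 = n%:Z - 1.
  apply: cpt; split; rewrite ?hj1 ?hjn // => k; case hk: (strand_at d k) => [t|] // _.
    by case: leP => // /(mono _ _ _ _ hk hj1); have := rng _ _ hk; lia.
  by case: leP => // /(mono _ _ _ _ hjn hk); have := rng _ _ hk; lia.
have inc s t j k : strand_at d j = Some s -> strand_at d k = Some t ->
    (s < t)%N -> j < k.
  move=> hj hk st; case: ltgtP => //.
    by move=> /(mono _ _ _ _ hk hj); lia.
  by move=> jk; move: hk; rewrite -jk hj => -[]; lia.
have low t j : strand_at d j = Some t -> j1 - 1 + t%:Z <= j.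
  elim: t j => [|t IHt] j hj; first by have := rng _ _ hj; lia.
  have [t0|t_gt0] := posnP t.
    case: leP => // jlt; move: hj; rewrite t0 => hj.
    by have := mono j j1 _ _ hj hj1; lia.
  have [|k hk] := onto t; first by have := rng _ _ hj; lia.
  by have := inc _ _ _ _ hk hj (ltnSn t); have := IHt _ hk; lia.
have upp s t j : (s + t = n)%N -> strand_at d j = Some t -> j <= jn - s%:Z.
  elim: s t j => [|s IHs] t j st hj.
    have tn : t = n by lia.
    rewrite tn in hj; case: leP => // jlt.
    by have := mono jn j _ _ hjn hj; lia.
  have [|k hk] := onto t.+1; first by have := rng _ _ hj; lia.
  have := inc _ _ _ _ hj hk (ltnSn t).
  by have := IHs t.+1 k _ hk; lia.
have at_t t : (0 < t <= n)%N -> strand_at d (j1 - 1 + t%:Z) = Some t.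
  move=> ht; have [j hj] := onto t ht.
  have := low _ _ hj; have := upp (n - t)%N t j _ hj => h1 h2.
  by have -> : j1 - 1 + t%:Z = j by lia.
exists (j1 - 1) => j.
case hj: (strand_in n j) => [t|].
  by have [-> ht] := strand_in_Some hj; exact: at_t.
case hs: (strand_at d _) => [t|] //.
have ht := rng _ _ hs; have hs' := at_t t ht.
have [jt|jt|jt] := ltgtP j t%:Z.
- by have := mono _ _ _ _ hs hs'; lia.
- by have := mono _ _ _ _ hs' hs; lia.
- by move: hj; rewrite jt strand_in_nat.
Qed.

(** * Cells of a framed generation *)

Lemma is_left_pos1 d j : is_left_pos d (j + 1) = ~~ is_left_pos d j.
Proof. by rewrite /is_left_pos; lia. Qed.

Lemma is_left_posD d c p : is_left_pos d (c + 1) = p ->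
  forall j : nat, is_left_pos d (c + j%:Z) = (odd j == p).
Proof. by rewrite /is_left_pos => h j; lia. Qed.

Lemma cell_at_nth d k : cell_at d (gstart d + k.*2%:Z) = nth CellN (gcells d) k.
Proof.
rewrite /cell_at; have -> : ((gstart d + k.*2%:Z - gstart d) %/ 2)%Z = k%:Z by lia.
by [].
Qed.

Lemma cell_word_mem (C : cell) t b :
  ((t, b) \in cell_word C) <-> C = CellX (kind_of b) t.
Proof.
case: C => [|m i|m i|i|[] i] //=; rewrite mem_seq1; split.
- by move/eqP=> [-> ->].
- by case: b => // -[->].
- by move/eqP=> [-> ->].
- by case: b => // -[->].
Qed.

Lemma mem_cells_word (s : seq cell) t b :
  ((t, b) \in flatten [seq cell_word C | C <- s]) <->
  exists k, nth CellN s k = CellX (kind_of b) t.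
Proof.
elim: s => [|C s IHs] /=; first by split=> // -[k]; rewrite nth_nil.
rewrite mem_cat; split=> [/orP[/cell_word_mem hC|/IHs[k hk]]|[[|k] hk]].
- by exists 0%N.
- by exists k.+1.
- by apply/orP; left; apply/cell_word_mem.
- by apply/orP; right; apply/IHs; exists k.
Qed.

(** The hypothesis says that the crossing in the k-th cell has the number given
by its position; reading the cells from left to right then gives increasing
indices. *)
Lemma sorted_cells_word (s : seq cell) (e : int) :
    (forall k kd t, nth CellN s k = CellX kd t -> e + k.*2%:Z = t%:Z) ->
  sorted ltn [seq x.1 | x <- flatten [seq cell_word C | C <- s]].
Proof.
move=> hs; rewrite sorted_pairwise; last exact: ltn_trans.
elim: s e hs => //= C s IHs e hs.
rewrite map_cat pairwise_cat (IHs (e + 2)) ?andbT; last first.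
  by move=> k kd t hk; rewrite -(hs k.+1 kd t hk); lia.
apply/andP; split; last by case: C {hs} => // -[].
apply/allrelP => x y /mapP[[t b] /cell_word_mem hC ->] /mapP[[t' b'] + ->] /=.
move=> /mem_cells_word[k hk]; have := hs 0%N _ _ hC; have := hs k.+1 _ _ hk.
by lia.
Qed.

Section Framed.

Variables (n : nat) (c : int) (d : generation).
Hypothesis framed_d : framed n c d.

Lemma left_strand_framed j : is_left_pos d (c + j) ->
  left_strand (cell_at d (c + j)) = strand_in n j.
Proof. by move=> hj; rewrite -framed_d /strand_at hj. Qed.

Lemma right_strand_framed j : is_left_pos d (c + j) ->
  right_strand (cell_at d (c + j)) = strand_in n (j + 1).
Proof.
move=> hj; rewrite -framed_d /strand_at addrA is_left_pos1 hj /=.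
by rewrite addrK.
Qed.

Lemma cell_strands j : is_left_pos d j ->
  left_strand (cell_at d j) = strand_in n (j - c) /\
  right_strand (cell_at d j) = strand_in n (j + 1 - c).
Proof.
move=> hj; have jE : j = c + (j - c) by lia.
have hj' := hj; rewrite jE in hj'.
rewrite {1 3}jE left_strand_framed // right_strand_framed //.
by split=> //; congr strand_in; lia.
Qed.

Lemma nth_cell_pos k kd t : nth CellN (gcells d) k = CellX kd t ->
  gstart d + k.*2%:Z = c + t%:Z.
Proof.
move=> hk; have := cell_at_nth d k; rewrite hk => hc.
have hl : is_left_pos d (c + (gstart d + k.*2%:Z - c)) by rewrite /is_left_pos; lia.
have := left_strand_framed hl.
have -> : c + (gstart d + k.*2%:Z - c) = gstart d + k.*2%:Z by lia.
by rewrite hc /= => /esym/strand_in_Some[]; lia.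
Qed.

(** In a framed generation the word determines which cells are crossings and of
which kind, since a letter tells the position of its cell. *)
Lemma gen_wordP t b : (t, b) \in gen_word d <->
  is_left_pos d (c + t%:Z) /\ cell_at d (c + t%:Z) = CellX (kind_of b) t.
Proof.
split=> [/mem_cells_word[k hk]|[hl hX]].
  rewrite -(nth_cell_pos hk) cell_at_nth; split=> //.
  by rewrite /is_left_pos; lia.
apply/mem_cells_word; move: hX; rewrite /cell_at.
by case: (_ %/ _)%Z => // k hk; exists k.
Qed.

Lemma sorted_gen_word : sorted ltn [seq x.1 | x <- gen_word d].
Proof.
apply: (@sorted_cells_word _ (gstart d - c)) => k kd t hk.
by have := nth_cell_pos hk; lia.
Qed.

Lemma gen_word_is_word : is_word n (gen_word d).
Proof.
apply/allP=> -[t b] /= /gen_wordP[hl hX].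
have := left_strand_framed hl; have := right_strand_framed hl.
rewrite hX => /esym/strand_in_Some; case=> ? ?.
by case/esym/strand_in_Some; lia.
Qed.

Variable p : bool.
Hypothesis parity_d : is_left_pos d (c + 1) = p.

Lemma gen_word_admissible : admissible p (gen_word d).
Proof.
rewrite /admissible sorted_gen_word andbT; apply/allP=> -[t b] /gen_wordP[] /=.
by rewrite (is_left_posD parity_d).
Qed.

(** A cell between two strand positions of the frame holds two strands, so it is
a crossing listed in the word or a pair of straight strands. *)
Lemma inner_cell (j : nat) : odd j = p -> (0 < j < n)%N ->
  cell_at d (c + j%:Z) = gamma_cell n (gen_word d) j.
Proof.
move=> oj jn; have hl : is_left_pos d (c + j%:Z).
  by rewrite (is_left_posD parity_d) oj eqxx.
have hL : left_strand (cell_at d (c + j%:Z)) = Some j.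
  by rewrite left_strand_framed // strand_in_nat //; lia.
have hR : right_strand (cell_at d (c + j%:Z)) = Some j.+1.
  rewrite right_strand_framed //; have -> : j%:Z + 1 = j.+1%:Z by lia.
  by rewrite strand_in_nat //; lia.
rewrite /gamma_cell.
case: ifP => [/gen_wordP[] //|h1]; case: ifP => [/gen_wordP[] //|h2].
have -> : (0 < j <= n)%N by lia.
have -> : (j < n)%N by lia.
case hC: (cell_at _ _) hL hR => [|m i|m i|i|k i] //= [ij] _; subst i => //.
have hX b : k = kind_of b -> (j, b) \in gen_word d.
  by move=> kb; apply/gen_wordP; rewrite hl hC kb.
by case: k hX {hC} => hX; [move: h1|move: h2]; rewrite hX.
Qed.

(** Outside the interior a cell has at most one strand, whose number is forced by
the frame and whose state is straight by steadiness. *)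
Lemma steady_cell (j : nat) : odd j = p -> steady (cell_at d (c + j%:Z)) ->
  cell_at d (c + j%:Z) = gamma_cell n (gen_word d) j.
Proof.
move=> oj; have [jn _|jn] := boolP (0 < j < n)%N; first exact: inner_cell.
have hl : is_left_pos d (c + j%:Z) by rewrite (is_left_posD parity_d) oj eqxx.
have := left_strand_framed hl; have := right_strand_framed hl.
have -> : j%:Z + 1 = j.+1%:Z by lia.
have notin b : (j, b) \in gen_word d = false.
  by apply/negP => /(allP gen_word_is_word) /=; rewrite (negbTE jn).
rewrite /gamma_cell !notin /strand_in /=.
have : ~~ ((j < n) && (0 < j <= n))%N by lia.
case: (j < n)%N; case: (0 < j <= n)%N => // _.
- by case: (cell_at _ _) => [|[] i|[] i|i|k i] //= -[->].
- by case: (cell_at _ _) => [|[] i|[] i|i|k i] //= _ [->].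
- by case: (cell_at _ _) => [|[] i|[] i|i|k i].
Qed.

End Framed.

Arguments gen_wordP {n c d}.

(** * The generations of gamma *)

Lemma left_strand_gamma n u j : is_word n u ->
  left_strand (gamma_cell n u j) = strand_in n j%:Z.
Proof.
move=> hu; rewrite /gamma_cell /=.
have inu b : (j, b) \in u -> (0 < j < n)%N by move/(allP hu).
case: ifP => [/inu h|_]; first by have -> : (0 < j <= n)%N by lia.
case: ifP => [/inu h|_]; first by have -> : (0 < j <= n)%N by lia.
by case: (0 < j <= n)%N; case: (j < n)%N.
Qed.

Lemma right_strand_gamma n u j : is_word n u ->
  right_strand (gamma_cell n u j) = strand_in n (j%:Z + 1).
Proof.
move=> hu; have -> : j%:Z + 1 = j.+1%:Z by lia.
rewrite /gamma_cell /=.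
have inu b : (j, b) \in u -> (0 < j < n)%N by move/(allP hu).
case: ifP => [/inu h|_]; first by have -> : (j < n)%N by lia.
case: ifP => [/inu h|_]; first by have -> : (j < n)%N by lia.
by case: (0 < j <= n)%N; case: (j < n)%N.
Qed.

(** Justifies that gamma_gen lists only finitely many cells. *)
Lemma gamma_cell_default n u j : is_word n u -> (n < j)%N ->
  gamma_cell n u j = CellN.
Proof.
move=> hu nj; rewrite /gamma_cell.
have inu b : (j, b) \in u = false by apply/negP => /(allP hu) /=; lia.
rewrite !inu; have -> : (0 < j <= n)%N = false by lia.
by have -> : (j < n)%N = false by lia.
Qed.

Lemma steady_gamma_cell n u j : steady (gamma_cell n u j).
Proof.
rewrite /gamma_cell; do 2![case: ifP => // _].
by case: (0 < j <= n)%N; case: (j < n)%N.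
Qed.

Lemma is_left_pos_gamma n p u (j : nat) :
  is_left_pos (gamma_gen n p u) j%:Z = (odd j == p).
Proof. by rewrite /is_left_pos /=; case: p => /=; lia. Qed.

Lemma cell_at_gamma n p u (j : nat) : is_word n u -> odd j = p ->
  cell_at (gamma_gen n p u) j%:Z = gamma_cell n u j.
Proof.
move=> hu oj; rewrite /cell_at /gamma_gen /gstart /gcells.
have -> : ((j%:Z - (nat_of_bool p)%:Z) %/ 2)%Z = j./2%:Z by rewrite -oj; lia.
have jE : (p + j./2.*2 = j)%N by rewrite -oj odd_double_half.
have [hj|hj] := ltnP j./2 (n./2).+1.
  by rewrite (nth_map 0%N) ?size_iota // nth_iota // add0n jE.
by rewrite nth_default ?size_map ?size_iota // gamma_cell_default //; lia.
Qed.

Lemma cell_at_gamma_neg n p u k : cell_at (gamma_gen n p u) (Negz k) = CellN.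
Proof.
rewrite /cell_at /=; case hq: (_ %/ _)%Z => [q|] //.
by move: hq; case: p => /=; lia.
Qed.

Lemma framed_gamma n p u : is_word n u -> framed n 0 (gamma_gen n p u).
Proof.
move=> hu j; rewrite add0r /strand_at; case: j => j.
  rewrite is_left_pos_gamma; have [oj|oj] := eqVneq (odd j) p.
    by rewrite cell_at_gamma // left_strand_gamma.
  case: j oj => [|j] oj.
    have -> : (0%:Z - 1 : int) = Negz 0 by [].
    by rewrite cell_at_gamma_neg.
  have -> : j.+1%:Z - 1 = j%:Z by lia.
  rewrite cell_at_gamma ?right_strand_gamma //.
    by have -> : j%:Z + 1 = j.+1%:Z by lia.
  by move: oj => /=; case: (odd j) (p) => -[].
have -> : Negz j - 1 = Negz j.+1 by lia.
by rewrite !cell_at_gamma_neg; case: ifP.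
Qed.

Lemma letter_unique (u : word) t b b' : sorted ltn [seq x.1 | x <- u] ->
  (t, b) \in u -> (t, b') \in u -> b = b'.
Proof.
elim: u => //= x u IHu su; have {}IHu := IHu (path_sorted su).
have /allP xu := order_path_min ltn_trans su.
have notin e : x = (t, e) -> forall e', (t, e') \in u -> False.
  by move=> xE e' /(map_f fst) /xu; rewrite xE ltnn.
rewrite !inE => /orP[/eqP ex|bu] /orP[/eqP ex'|bu'].
- by move: ex'; rewrite -ex => -[].
- by case: (notin _ (esym ex) _ bu').
- by case: (notin _ (esym ex') _ bu).
- exact: IHu.
Qed.

(** Both words have increasing indices, so it is enough to compare their letters,
and these are the crossings of the generation. *)
Lemma gen_word_gamma_gen n p u : is_word n u -> admissible p u ->
  gen_word (gamma_gen n p u) = u.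
Proof.
move=> hu /andP[/allP pu su]; have fr := @framed_gamma n p u hu.
have ltn1 : transitive (relpre (fst : letter -> nat) ltn).
  by move=> y x z; apply: ltn_trans.
apply: (@irr_sorted_eq _ _ ltn1) => [x|||]; first exact: ltnn.
- by have := sorted_gen_word fr; rewrite sorted_map.
- by move: su; rewrite sorted_map.
move=> [t b]; apply/idP/idP.
  move=> /(gen_wordP fr)[]; rewrite add0r is_left_pos_gamma => /eqP ot.
  rewrite cell_at_gamma // /gamma_cell.
  case: ifP => [h|_]; first by case: b.
  case: ifP => [h|_]; first by case: b.
  by case: (0 < t <= n)%N; case: (t < n)%N.
move=> tu; apply/(gen_wordP fr); rewrite add0r is_left_pos_gamma.
have ot := pu _ tu; split=> //; rewrite cell_at_gamma ?(eqP ot) //.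
rewrite /gamma_cell; case: ifP => [h|h].
  by rewrite (letter_unique su tu h).
by case: b tu h {ot} => [->|->].
Qed.

(** * Greedy parsing *)

Lemma onth_lt (T : Type) (s : seq T) i :
  (i < size s)%N <-> exists x, onth s i = Some x.
Proof.
rewrite -onthTE; split=> [|[x ->] //].
by case: (onth s i) => // x _; exists x.
Qed.

Lemma nth_gen_word (g : pattern) i d : onth g i = Some d ->
  nth [::] [seq gen_word e | e <- g] i = gen_word d.
Proof.
move=> hd; have hi : (i < size g)%N by apply/onth_lt; exists d.
by rewrite (nth_map d) //; congr gen_word; exact: onth_nth.
Qed.

Lemma admissible_take p i u : admissible p u -> admissible p (take i u).
Proof.
move=> /andP[pu su]; apply/andP; split.
  by apply/allP => x /mem_take /(allP pu).
by rewrite map_take take_sorted.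
Qed.

Lemma admissible_prefix p w : admissible p (take (prefix_size p w) w).
Proof.
rewrite /prefix_size.
apply: (big_ind (fun i => admissible p (take i w))) => [|i j hi hj|i //].
  by rewrite take0.
by case: (leqP i j).
Qed.

(** Prefixes of admissible words are admissible, so a prefix that cannot be
prolonged by one letter cannot be prolonged at all. *)
Lemma prefix_size_cat p u v : admissible p u ->
    (if v is x :: _ then ~~ admissible p (rcons u x) else true) ->
  prefix_size p (u ++ v) = size u.
Proof.
move=> pu hv; apply/eqP; rewrite eqn_leq; apply/andP; split.
  apply/bigmax_leqP => i; case: v hv i => [_ i _|x v hx i].
    have e : size (u ++ [::]) = size u by rewrite cats0.
    by have := ltn_ord i; lia.
  apply: contraTT; rewrite -ltnNge => ui; apply: contra hx => /(admissible_take (size u).+1).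
  by rewrite take_takel // take_cat ltnNge leqnSn /= subSnn /= take0 cats1.
have hi : (size u < (size (u ++ v)).+1)%N by rewrite size_cat ltnS leq_addr.
have pi : admissible p (take (Ordinal hi) (u ++ v)) by rewrite /= take_size_cat.
exact: (leq_bigmax_cond (Ordinal hi) pi).
Qed.

Lemma psi_cons d g : psi (d :: g) = gen_word d ++ psi g.
Proof. by []. Qed.

(** The bound on the fuel counts two steps per letter: a step whose parity does
not suit the next letter consumes nothing, but the step after it does. *)
Lemma psi_gamma_from n f p w : is_word n w ->
    ((size w).*2 + (if w is x :: _ then odd x.1 != p else false) <= f)%N ->
  psi (gamma_from n f p w) = w.
Proof.
elim: f p w => [|f IHf] p [|x w] // hw hf.
set w' := x :: w in hw hf *.
have -> : gamma_from n f.+1 p w' = gamma_gen n p (take (prefix_size p w') w') ::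
  gamma_from n f (~~ p) (drop (prefix_size p w') w') by [].
rewrite psi_cons.
have /andP[hw1 hw2] : is_word n (take (prefix_size p w') w') &&
    is_word n (drop (prefix_size p w') w').
  by rewrite /is_word -all_cat cat_take_drop.
rewrite gen_word_gamma_gen ?admissible_prefix // IHf ?cat_take_drop //.
have [px|px] := eqVneq (odd x.1) p.
  have := @prefix_size_gt0 p x w; rewrite px eqxx => /(_ isT).
  rewrite /w'; case: (prefix_size _ _) => // i _ /=.
  have : (size (drop i w) <= size w)%N by rewrite size_drop leq_subr.
  move: hf; rewrite /= px eqxx.
  by case: (drop i w) => [|y v] /=; last case: (odd y.1 != ~~ p); lia.
have -> : prefix_size p w' = 0%N.
  by apply: (@prefix_size_cat p [::] w') => //=; rewrite /admissible /= (negbTE px).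
rewrite drop0; move: hf px; rewrite /w' /=; case: (odd _) (p) => -[] //=; lia.
Qed.

Lemma gamma_from_gen n f p w r d : is_word n w ->
    onth (gamma_from n f p w) r = Some d ->
  exists q u, is_word n u /\ d = gamma_gen n q u.
Proof.
elim: f p w r => [|f IHf] p [|x w] r hw; rewrite ?onth0n //.
move: hw; rewrite -[x :: w](cat_take_drop (prefix_size p (x :: w))) /is_word.
rewrite all_cat => /andP[hw1 hw2].
rewrite cat_take_drop; case: r => [[<-]|r]; last exact: IHf hw2.
by exists p, (take (prefix_size p (x :: w)) (x :: w)).
Qed.

(** Only an implication: gamma stops at the last letter, whereas the list us may
end with empty words. *)
Lemma gamma_from_parse n f p (us : seq word) r d :
    (forall r, (r < size us)%N ->
     prefix_size (p (+) odd r) (flatten (drop r us)) = size (nth [::] us r)) ->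
    onth (gamma_from n f p (flatten us)) r = Some d ->
  (r < size us)%N /\ d = gamma_gen n (p (+) odd r) (nth [::] us r).
Proof.
elim: f p us r => [|f IHf] p us r hus; first by rewrite onth0n.
case: us hus => [|u us] hus; first by rewrite onth0n.
have pu := hus 0%N isT; rewrite addbF drop0 /= in pu.
rewrite [flatten _]/=; case E: (u ++ _) => [|x w]; first by rewrite onth0n.
rewrite -E.
have -> : gamma_from n f.+1 p (u ++ flatten us) =
    gamma_gen n p u :: gamma_from n f (~~ p) (flatten us).
  by rewrite E /= -E pu take_size_cat // drop_size_cat.
case: r => [[<-]|r /IHf[|rus ->]]; first by rewrite addbF.
  by move=> i ius; have := hus i.+1 ius; rewrite /= addNb addbN.
by rewrite /= addNb addbN.
Qed.

(** The last hypothesis is the dichotomy for the successor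
of an empty word: s is true when two straight strands make a crossing, and then
the successor has every index of its parity; otherwise it is empty too.  When U r
could be prolonged by a letter x of a later word, U r.+1 is empty by parity, and
either case of the dichotomy leads to a contradiction: empty words forever would
exclude x, and a full U r.+2 makes x the least letter of its parity, hence U r empty
and U r.+1 full. *)
Lemma greedy_parse n p (s : bool) (us : seq word) :
    let U r := nth [::] us r in
    (1 < n)%N -> U 0%N <> [::] ->
    (forall r, is_word n (U r)) ->
    (forall r, admissible (p (+) odd r) (U r)) ->
    (forall r, (r.+1 < size us)%N -> U r = [::] ->
       if s then forall j, (0 < j < n)%N -> odd j = p (+) odd r.+1 ->
                 j \in [seq x.1 | x <- U r.+1]
       else U r.+1 = [::]) ->
  forall r, (r < size us)%N ->
    prefix_size (p (+) odd r) (flatten (drop r us)) = size (U r).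
Proof.
move=> U n_gt1 U0 hw ha hs r r_lt.
rewrite (drop_nth [::]) //= prefix_size_cat //.
(* Suppose that the word at r could take the next letter x as well. *)
case hv: (flatten _) => [//|x v]; apply/negP => hx.
have xr : odd x.1 = p (+) odd r.
  by case/andP: hx => /allP/(_ x); rewrite mem_rcons inE eqxx => /(_ isT)/eqP.
have dropU k : (k < size us)%N -> flatten (drop k us) = U k ++ flatten (drop k.+1 us).
  by move=> hk; rewrite (drop_nth [::]).
have lt1 : (r.+1 < size us)%N.
  by rewrite ltnNge; apply/negP => /drop_oversize h; rewrite h in hv.
(* Otherwise its first letter would be x, which has the wrong parity. *)
have U1 : U r.+1 = [::].
  move: hv; rewrite dropU //; have /andP[] := ha r.+1.
  case: (U r.+1) => // y u /= /andP[/eqP yr _] _ [yx _].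
  by move: yr; rewrite yx xr; case: (p) (odd r) => -[].
rewrite dropU // U1 /= in hv.
have lt2 : (r.+2 < size us)%N.
  by rewrite ltnNge; apply/negP => /drop_oversize h; rewrite h in hv.
have [k hk xk] : exists2 k, (r.+2 + k < size us)%N & x \in U (r.+2 + k)%N.
  have : x \in flatten (drop r.+2 us) by rewrite hv inE eqxx.
  case/flattenP => u /(nthP [::])[k]; rewrite size_drop nth_drop => hk <- xk.
  by exists k; rewrite // -ltn_subRL.
case: s hs => hs; last first.
  have Uempty i : (r < i)%N -> (i < size us)%N -> U i = [::].
    elim: i => // i IHi; rewrite ltnS leq_eqVlt => /orP[/eqP <- //|ri] hi.
    by apply: hs => //; apply: IHi => //; apply: ltnW.
  by move: xk; rewrite Uempty // ltnW // ltn_addr.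
have full := hs _ lt2 U1.
have r2 : p (+) odd r.+2 = p (+) odd r by rewrite /= negbK.
rewrite r2 in full.
have xw : (0 < x.1 < n)%N by have /allP/(_ x xk) := hw (r.+2 + k)%N.
(* The least index of the parity of x. *)
set m := if p (+) odd r then 1%N else 2.
have mx : (m <= x.1)%N by move: xr xw; rewrite /m; case: (_ (+) _); lia.
have om : odd m = p (+) odd r by rewrite /m; case: (_ (+) _).
have m_in : m \in [seq y.1 | y <- U r.+2].
  apply: full => //; case/andP: xw => _ xn.
  by rewrite (leq_ltn_trans mx xn) andbT /m; case: ifP.
(* Since U r.+2 is full, m comes first in it, and so does x. *)
have xm : x.1 = m.
  have [y [u U2]] : exists y u, U r.+2 = y :: u.
    by case: (U r.+2) m_in => // y u _; exists y, u.
  have /andP[_] := ha r.+2; move: m_in; rewrite U2 /= inE.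
  have -> : y = x by move: hv; rewrite dropU // U2 => -[].
  case/orP=> [/eqP mE _|mu]; first exact: esym mE.
  move=> /(order_path_min ltn_trans)/allP/(_ _ mu); lia.
have Ur : U r = [::].
  case E: (U r) (hw r) => [//|y u] /= /andP[y0 _].
  have /andP[/allP/(_ y) yr _] := ha r; rewrite E inE eqxx in yr.
  case/andP: hx => _; rewrite -/(U r) E /= map_rcons => /(order_path_min ltn_trans).
  rewrite all_rcons xm => /andP[ym _].
  by move: (yr isT) y0 ym; rewrite /m; case: (_ (+) _); lia.
case: r Ur U1 lt1 lt2 {xr hx hv full r2 m mx om m_in xm r_lt k hk xk} => [//|r] U1 U2 lt2 _.
(* The former r is now r.+1.  The words at r.+1 and r.+2 are both empty, although
   the second is full; so no index has its parity, which leaves only n = 2. *)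
have void j : (0 < j < n)%N -> odd j = p (+) odd r -> False.
  have := hs _ lt2 U1; rewrite U2 /= negbK => h ? ?; by have := h j; rewrite in_nil; auto.
have pr : p (+) odd r = false by apply/negbTE/negP => h; apply: (void 1%N).
have n2 : n = 2.
  apply/eqP; rewrite eqn_leq n_gt1 leqNgt !andbT; apply/negP => n3.
  exact: (void 2).
have U0' : U r = [::].
  case E: (U r) (hw r) (ha r) => [//|y u] /= /andP[yn _] /andP[/andP[/eqP yr _] _].
  by move: yr yn; rewrite pr n2; case: (y.1) => [|[|]].
have := hs _ (ltnW lt2) U0' 1%N; rewrite U1 /= n2 in_nil => /(_ isT).
by rewrite addbN pr => /(_ erefl).
Qed.

(** * Compact patterns do not drift *)

Section Step.

Variables (n : nat) (c c' : int) (d d' : generation).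
Hypothesis n_gt1 : (1 < n)%N.
Hypotheses (framed_d : framed n c d) (framed_d' : framed n c' d').
Hypothesis parity_step : forall j, is_left_pos d' (j + 1) = is_left_pos d j.
Hypothesis children : forall j, is_left_pos d j ->
  (left_strand (cell_at d' (j + 1)) <> None <-> send_right (cell_at d j) <> None) /\
  (right_strand (cell_at d' (j + 1)) <> None <-> send_left (cell_at d (j + 2)) <> None).

Lemma occupied_right j : is_left_pos d j ->
  (0 < j + 1 - c' <= n%:Z) <-> send_right (cell_at d j) <> None.
Proof.
move=> hj; have [<- _] := children hj; rewrite -(framedP _ framed_d').
by rewrite /strand_at parity_step hj.
Qed.

Lemma occupied_left j : is_left_pos d j ->
  (0 < j - c' <= n%:Z) <-> send_left (cell_at d j) <> None.
Proof.
move=> hj; have hj2 : is_left_pos d (j - 2) by move: hj; rewrite /is_left_pos; lia.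
have [_] := children hj2; have -> : j - 2 + 2 = j by lia.
have -> : j - 2 + 1 = j - 1 by lia.
move=> <-; rewrite -(framedP _ framed_d') /strand_at.
have -> : is_left_pos d' j = false.
  have -> : j = j - 1 + 1 by lia.
  by rewrite parity_step; move: hj; rewrite /is_left_pos; lia.
by [].
Qed.

(** A strand can only be sent by a nonempty cell, and those meet the frame. *)
Lemma sent_inside j : is_left_pos d j ->
  send_left (cell_at d j) <> None \/ send_right (cell_at d j) <> None ->
  (0 < j - c <= n%:Z) \/ (0 < j + 1 - c <= n%:Z).
Proof.
move=> /(cell_strands framed_d)[hL hR]; rewrite -!strand_inP -hL -hR.
by case: (cell_at d j) => [|[] i|[] i|i|k i] //= [] // _; by [left|right].
Qed.

(** A turning strand alone in its cell leaves the block of occupied positions and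
leaves vacant the place next to its new position; the other neighbour is out of
reach of the frame.  So it would be isolated in the next generation, which is
impossible as that one is a block of at least two positions. *)
Lemma steady_step j : is_left_pos d j -> steady (cell_at d j).
Proof.
move=> hj; have [hL hR] := cell_strands framed_d hj.
have oR := occupied_right hj; have oL := occupied_left hj.
case hC: (cell_at d j) hL hR oL oR => [|[] i|[] i|i|k i] //= hL hR oL oR.
  have [? ?] := strand_in_Some (esym hL); have ? := strand_in_None (esym hR).
  have hj2 : is_left_pos d (j + 2) by move: hj; rewrite /is_left_pos; lia.
  have in2 := occupied_left hj2.
  have [_ /(_ isT) ?] : (0 < j + 1 - c' <= n%:Z) <-> true by rewrite oR.
  have ? : ~ (0 < j - c' <= n%:Z) by rewrite oL.
  have ? : ~ (0 < j + 2 - c' <= n%:Z).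
    by move=> /in2 h; have := sent_inside hj2 (or_introl h); lia.
  by lia.
have [? ?] := strand_in_Some (esym hR); have ? := strand_in_None (esym hL).
have hj2 : is_left_pos d (j - 2) by move: hj; rewrite /is_left_pos; lia.
have in2 := occupied_right hj2.
have [_ /(_ isT) ?] : (0 < j - c' <= n%:Z) <-> true by rewrite oL.
have ? : ~ (0 < j + 1 - c' <= n%:Z) by rewrite oR.
have ? : ~ (0 < j - 2 + 1 - c' <= n%:Z).
  by move=> /in2 h; have := sent_inside hj2 (or_intror h); lia.
by lia.
Qed.

(** Steady cells occupy, in the next generation, exactly the positions that they
occupy in this one. *)
Lemma frame_step : c' = c.
Proof.
have same x : (0 < x - c' <= n%:Z) <-> (0 < x - c <= n%:Z).
  have [hx|hx] := boolP (is_left_pos d x).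
    rewrite (occupied_left hx); have [hL _] := cell_strands framed_d hx.
    rewrite -strand_inP -hL; have := steady_step hx.
    by case: (cell_at d x) => [|[] i|[] i|i|k i].
  have hx1 : is_left_pos d (x - 1) by move: hx; rewrite /is_left_pos; lia.
  have xE : x = x - 1 + 1 by lia.
  rewrite [in X in X <-> _]xE [in X in _ <-> X]xE.
  rewrite (occupied_right hx1); have [_ hR] := cell_strands framed_d hx1.
  rewrite -strand_inP -hR; have := steady_step hx1.
  by case: (cell_at d (x - 1)) => [|[] i|[] i|i|k i].
have := same (c + 1); have := same (c' + 1); lia.
Qed.

End Step.

(** * From a compact pattern to gamma *)

Section Compact.

Variables (n : nat) (g : pattern) (tau : option turn -> option turn -> turn).
Variable kappa : option kind -> option kind -> kind.
Hypotheses (n_gt1 : (1 < n)%N) (grid_g : is_grid_pattern n g).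
Hypotheses (cont_g : is_continuous g) (compact_g : is_compact n g).
Hypotheses (tau_g : is_turning_rule tau g) (kappa_g : is_crossing_rule kappa g).

Lemma framed_pattern :
  exists c, forall r d, onth g r = Some d -> framed n c d.
Proof.
have frame r d : onth g r = Some d -> exists c, framed n c d.
  move=> hd; apply: compact_framed; [exact: ltnW|exact: grid_g hd|].
  exact: compact_g hd.
case h0: (onth g 0%N) => [d0|]; last first.
  have g0 : size g = 0%N by have := onthTE g 0; rewrite h0 /=; lia.
  by exists 0 => r d hd; have := onthTE g r; rewrite hd g0.
have [c hc] := frame _ _ h0; exists c; elim=> [|r IHr] d hd.
  by move: hd; rewrite h0 => -[<-].
have /onth_lt[e he] : (r < size g)%N by apply/ltnW/onth_lt; exists d.
have [c' hc'] := frame _ _ hd.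
have <- // : c' = c.
apply: (frame_step n_gt1 (IHr _ he) hc'); first exact: cont_g.1 he hd.
exact: cont_g.2 he hd.
Qed.

Variable c : int.
Hypothesis framed_g : forall r d, onth g r = Some d -> framed n c d.
Variables (d0 : generation).
Hypotheses (head_g : onth g 0%N = Some d0) (cross_d0 : gen_word d0 <> [::]).
Let p := is_left_pos d0 (c + 1).

Lemma parity_pattern r d : onth g r = Some d ->
  is_left_pos d (c + 1) = p (+) odd r.
Proof.
elim: r d => [|r IHr] d hd.
  by move: hd; rewrite head_g addbF => -[<-].
have /onth_lt[e he] : (r < size g)%N by apply/ltnW/onth_lt; exists d.
rewrite (cont_g.1 _ _ _ he hd) addbN -(IHr _ he).
by rewrite -[in RHS](addrK 1 c) /is_left_pos; lia.
Qed.

Lemma inner_steady r d d' j : onth g r = Some d -> onth g r.+1 = Some d' ->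
  is_left_pos d j -> steady (cell_at d j).
Proof.
move=> hd hd'; apply: steady_step n_gt1 (framed_g hd) (framed_g hd') _ _ _.
  exact: cont_g.1 hd hd'.
exact: cont_g.2 hd hd'.
Qed.

(** The dichotomy asked for by greedy_parse: if a generation that is not the last has
no crossings, all its strands are straight, so each child with two strands has
the turning state tau(S, S). *)
Lemma gen_word_greedy r : (r < size g)%N ->
  prefix_size (p (+) odd r) (flatten (drop r [seq gen_word d | d <- g])) =
  size (nth [::] [seq gen_word d | d <- g] r).
Proof.
set us := [seq gen_word d | d <- g].
have us_none i : onth g i = None -> nth [::] us i = [::].
  by move=> hi; rewrite nth_default // size_map -onthNE hi.
move=> hr; set s := if tau (Some Straight) (Some Straight) is Turn then true else false.
apply: (@greedy_parse n p s us) => //; last by rewrite size_map.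
- by rewrite (nth_gen_word head_g).
- move=> i; case hi: (onth g i) => [d|]; last by rewrite us_none.
  by rewrite (nth_gen_word hi); exact: gen_word_is_word (framed_g hi).
- move=> i; case hi: (onth g i) => [d|]; last by rewrite us_none.
  by rewrite (nth_gen_word hi); exact: gen_word_admissible (framed_g hi) _ (parity_pattern hi).
move=> i; rewrite size_map => hi1.
have /onth_lt[d hd] := ltnW hi1; have /onth_lt[d' hd'] := hi1.
rewrite (nth_gen_word hd) (nth_gen_word hd') => wd0.
have turn_inner j : (0 < j < n)%N -> odd j = p (+) odd i.+1 ->
    cell_turn (gamma_cell n (gen_word d') j) = Some (tau (Some Straight) (Some Straight)).
  case: j => // j jn oj.
  have oj' : odd j = p (+) odd i by move: oj; rewrite /= addbN => /negb_inj.
  have hl : is_left_pos d (c + j%:Z).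
    by rewrite (is_left_posD (parity_pattern hd)) oj' eqxx.
  have := tau_g hd hd' hl.
  have -> : c + j%:Z + 2 = c + j.+2%:Z by lia.
  have -> : c + j%:Z + 1 = c + j.+1%:Z by lia.
  have hl2 : is_left_pos d (c + j.+2%:Z).
    by rewrite (is_left_posD (parity_pattern hd)) /= negbK oj' eqxx.
  rewrite (steady_cell (framed_g hd) (parity_pattern hd) oj' (inner_steady hd hd' hl)).
  have oj2 : odd j.+2 = p (+) odd i by rewrite /= negbK.
  rewrite (steady_cell (framed_g hd) (parity_pattern hd) oj2 (inner_steady hd hd' hl2)).
  rewrite (inner_cell (framed_g hd') (parity_pattern hd') oj jn) wd0.
  have -> : send_right (gamma_cell n [::] j) = Some Straight.
    rewrite /gamma_cell /=; have -> : (j < n)%N by lia.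
    by case: (0 < j <= n)%N.
  have -> : send_left (gamma_cell n [::] j.+2) = Some Straight.
    rewrite /gamma_cell /=; have -> : (j.+1 < n)%N by lia.
    by case: (j.+2 < n)%N.
  apply; rewrite /gamma_cell; do 2![case: ifP => // _].
  by case/andP: jn => _ jn; rewrite jn (ltnW jn).
rewrite /s; case hs: (tau _ _) turn_inner => turn_inner.
  case E: (gen_word d') => [//|[t b] u].
  have tb : (t, b) \in gen_word d' by rewrite E inE eqxx.
  have := turn_inner t (allP (gen_word_is_word (framed_g hd')) _ tb).
  have /andP[/allP/(_ _ tb)/eqP -> _] := gen_word_admissible (framed_g hd') (parity_pattern hd').
  move=> /(_ erefl); rewrite /gamma_cell.
  by case: ifP => // h1; case: ifP => // h2; case: b tb {E} => tb; [case/idP: h1|case/idP: h2].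
move=> j jn oj; have := turn_inner j jn oj.
rewrite /gamma_cell; case: ifP => [h _|_]; first by apply/mapP; exists (j, true).
case: ifP => [h _|_]; first by apply/mapP; exists (j, false).
have -> : (0 < j <= n)%N by lia.
by have -> : (j < n)%N by lia.
Qed.

Lemma onth_gamma_psi r d : onth (gamma n (psi g)) r = Some d ->
  exists2 e, onth g r = Some e & d = gamma_gen n (p (+) odd r) (gen_word e).
Proof.
have [g' gE] : exists g', g = d0 :: g'.
  by case: (g) head_g => //= a l [->]; exists l.
have -> : gamma n (psi g) = gamma_from n (size (psi g)).*2 p (psi g).
  have := gen_word_admissible (framed_g head_g) (parity_pattern head_g).
  rewrite addbF /gamma [in psi g]gE psi_cons.
  by case: (gen_word d0) cross_d0 => //= x u _ /andP[/andP[/eqP -> _] _].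
have -> : psi g = flatten [seq gen_word e | e <- g] by [].
move=> /gamma_from_parse[|rg ->].
  by move=> i; rewrite size_map; exact: gen_word_greedy.
rewrite size_map in rg; have [e he] := (onth_lt _ _).1 rg.
by exists e; rewrite // (nth_gen_word he).
Qed.

(** Children with two strands, and their parents, agree in g and in gamma: the
parents lie in a generation of g that is not the last, hence are steady, and the
child is an inner cell. *)
Lemma gamma_transfer r d d' j :
    onth (gamma n (psi g)) r = Some d -> onth (gamma n (psi g)) r.+1 = Some d' ->
    is_left_pos d j -> 0 < j + 1 < n%:Z ->
  exists e e', [/\ onth g r = Some e, onth g r.+1 = Some e', is_left_pos e (c + j)
    & [/\ cell_at d j = cell_at e (c + j),
          cell_at d (j + 2) = cell_at e (c + j + 2)
        & cell_at d' (j + 1) = cell_at e' (c + j + 1)]].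
Proof.
move=> /onth_gamma_psi[e he ->] /onth_gamma_psi[e' he' ->] hj jn.
have [m jE] : exists m : nat, j = m%:Z by exists `|j|%N; lia.
move: hj jn; rewrite {j}jE is_left_pos_gamma => /eqP om jn.
have pe := parity_pattern he; have pe' := parity_pattern he'.
have wu := gen_word_is_word (framed_g he); have wu' := gen_word_is_word (framed_g he').
have -> : m%:Z + 2 = m.+2%:Z by lia.
have -> : m%:Z + 1 = m.+1%:Z by lia.
have -> : c + m%:Z + 2 = c + m.+2%:Z by lia.
have -> : c + m%:Z + 1 = c + m.+1%:Z by lia.
have om2 : odd m.+2 = p (+) odd r by rewrite /= negbK.
have om1 : odd m.+1 = p (+) odd r.+1 by rewrite /= om addbN.
have lm : is_left_pos e (c + m%:Z) by rewrite (is_left_posD pe) om eqxx.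
have lm2 : is_left_pos e (c + m.+2%:Z) by rewrite (is_left_posD pe) om2 eqxx.
exists e, e'; rewrite !cell_at_gamma //; split=> //; split.
- by rewrite (steady_cell (framed_g he) pe om (inner_steady he he' lm)).
- by rewrite (steady_cell (framed_g he) pe om2 (inner_steady he he' lm2)).
- by rewrite (inner_cell (framed_g he') pe' om1) //; lia.
Qed.

Lemma SCA_gamma_psi : is_SCA_pattern n (gamma n (psi g)).
Proof.
have gen r d : onth (gamma n (psi g)) r = Some d ->
    framed n 0 d /\ (forall j, is_left_pos d j = (2 %| j - (p (+) odd r : nat)%:Z)%Z) /\
    (forall j, is_left_pos d j -> steady (cell_at d j)).
  move=> /onth_gamma_psi[e he ->]; have wu := gen_word_is_word (framed_g he).
  split; first exact: framed_gamma.
  split=> [//|[j|j]].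
  - by rewrite is_left_pos_gamma => /eqP ?; rewrite cell_at_gamma // steady_gamma_cell.
  - by rewrite cell_at_gamma_neg.
have strands r d d' j : onth (gamma n (psi g)) r = Some d ->
    onth (gamma n (psi g)) r.+1 = Some d' -> is_left_pos d j ->
    [/\ is_left_pos d' (j + 1),
        left_strand (cell_at d' (j + 1)) = right_strand (cell_at d j)
      & right_strand (cell_at d' (j + 1)) = left_strand (cell_at d (j + 2))].
  move=> /gen[fd [ld _]] /gen[fd' [ld' _]] hj.
  have hj2 : is_left_pos d (j + 2) by move: hj; rewrite /is_left_pos; lia.
  have hj1 : is_left_pos d' (j + 1).
    by move: hj; rewrite ld ld' /= addbN; case: (p (+) odd r) => /=; lia.
  have [-> ->] := cell_strands fd' hj1; have [_ ->] := cell_strands fd hj.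
  have [-> _] := cell_strands fd hj2; split=> //.
  by congr strand_in; lia.
have cont : is_continuous (gamma n (psi g)).
  split=> r d d' hd hd' j.
    have [_ [ld _]] := gen _ _ hd; have [_ [ld' _]] := gen _ _ hd'.
    by rewrite ld ld' /= addbN; case: (p (+) odd r) => /=; lia.
  move=> hj; have [_ -> ->] := strands _ _ _ _ hd hd' hj.
  have [_ [_ st]] := gen _ _ hd; have := st _ hj.
  have /st : is_left_pos d (j + 2) by move: hj; rewrite /is_left_pos; lia.
  by case: (cell_at d j) (cell_at d (j + 2)) => [|[] ?|[] ?|?|? ?] [|[] ?|[] ?|?|? ?].
have inside r d' j : onth (gamma n (psi g)) r.+1 = Some d' -> is_left_pos d' (j + 1) ->
    left_strand (cell_at d' (j + 1)) <> None ->
    right_strand (cell_at d' (j + 1)) <> None -> 0 < j + 1 < n%:Z.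
  move=> hd' hj1; have [fd' _] := gen _ _ hd'; have [-> ->] := cell_strands fd' hj1.
  by rewrite !strand_inP; lia.
split=> //.
- by move=> r d /gen[/framed_generation].
(* In gamma a child receiving one strand is at an end of the frame and straight,
   although g may turn such a strand in its last generation. *)
- exists (fun a b => if (a, b) is (Some _, Some _) then tau a b else Straight).
  move=> r d d' hd hd' j hj hC; have [hj1 _ _] := strands _ _ _ _ hd hd' hj.
  have [_ [_ st']] := gen _ _ hd'; have {}st' := st' _ hj1.
  have [hL hR] := cont.2 _ _ _ hd hd' _ hj.
  case hA: (send_right _) hL => [a|] hL; last first.
    have {}hL : left_strand (cell_at d' (j + 1)) = None.
      by case E: (left_strand _) hL => // -[/(_ _)h _]; case: h.
    by case: (cell_at d' (j + 1)) hC hL st' => [|[] ?|[] ?|?|? ?].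
  case hB: (send_left _) hR => [b|] hR; last first.
    have {}hR : right_strand (cell_at d' (j + 1)) = None.
      by case E: (right_strand _) hR => // -[/(_ _)h _]; case: h.
    by case: (cell_at d' (j + 1)) hC hR st' => [|[] ?|[] ?|?|? ?].
  have jn : 0 < j + 1 < n%:Z by apply: inside hd' hj1 _ _; [apply/hL|apply/hR].
  have [e [e' [he he' le [eA eB eC]]]] := gamma_transfer hd hd' hj jn.
  by rewrite -hA -hB eA eB eC; apply: (tau_g he he' le); rewrite -eC.
exists kappa => r d d' hd hd' j hj k t hC; have [hj1 _ _] := strands _ _ _ _ hd hd' hj.
have jn : 0 < j + 1 < n%:Z by apply: inside hd' hj1 _ _; rewrite hC.
have [e [e' [he he' le [eA eB eC]]]] := gamma_transfer hd hd' hj jn.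
by rewrite eA eB; apply: (kappa_g he he' le); rewrite -eC; exact: hC.
Qed.

End Compact.

Lemma SCA_behead n d g : is_SCA_pattern n (d :: g) -> is_SCA_pattern n g.
Proof.
case=> gr [par ch] [tau ht] [kappa hk].
split; [by move=> r; apply: (gr r.+1)| split| exists tau| exists kappa].
- by move=> r; apply: (par r.+1).
- by move=> r; apply: (ch r.+1).
- by move=> r; apply: (ht r.+1).
- by move=> r; apply: (hk r.+1).
Qed.

(** Generations before the first crossing can be dropped: gamma starts with the
first letter. *)
Lemma SCA_compact_gamma n g : (1 < n)%N -> psi g <> [::] ->
  is_SCA_pattern n g -> is_compact n g -> is_SCA_pattern n (gamma n (psi g)).
Proof.
move=> n_gt1; elim: g => [//|d g IHg] hpsi hg cg.
case wd: (gen_word d == [::]); move/eqP: wd => wd.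
  rewrite psi_cons wd in hpsi *; apply: IHg => //; first exact: SCA_behead hg.
  by move=> r; apply: (cg r.+1).
case: hg => gr cont [tau ht] [kappa hk].
have [c hc] := framed_pattern n_gt1 gr cont cg.
by apply: (@SCA_gamma_psi n _ tau kappa n_gt1 cont ht hk c hc d).
Qed.

Lemma SCA_nil n : is_SCA_pattern n [::].
Proof.
split; first by move=> r d; rewrite onth0n.
- by split=> r d d'; rewrite onth0n.
- by exists (fun _ _ => Straight) => r d d'; rewrite onth0n.
- by exists (fun _ _ => T1) => r d d'; rewrite onth0n.
Qed.

Theorem proposition4p12 (n : nat) (w : word) (hw : is_word n w) :
  compactly_SCA_representable n w <-> is_SCA_pattern n (gamma n w).
Proof.
split=> [[g [hg cg hpsi]]|hgamma].
  (* A nonempty word has a letter of index between 0 and n, so 1 < n. *)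
  case: w hw hpsi => [_ _|x w /andP[x1 _] hpsi]; first exact: SCA_nil.
  rewrite -hpsi; apply: SCA_compact_gamma => //; first by lia.
  by rewrite hpsi.
exists (gamma n w); split=> //.
  move=> r d; case: w hw {hgamma} => [|x w] hw; first by rewrite onth0n.
  move=> /(gamma_from_gen hw)[q [u [hu ->]]] j k.
  exact/framed_compact/framed_gamma.
case: w hw {hgamma} => // x w hw; rewrite psi_gamma_from // eqxx addn0.
exact: leqnn.
Qed.
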